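(* For each $\mu\in\mathcal{P}_T(\Theta)$ and each $t\in\mathbb{R}$ one has $\mu(S_t\setminus N_t)=0$.
   Context: $(\Theta,\mathcal{B})$ is a measurable space and $T:\Theta\to\Theta$ is bi-measurable (a measurable bijection with measurable inverse). $\mathcal{P}_T(\Theta)$ denotes the set of $T$-invariant probability measures on $(\Theta,\mathcal{B})$. Write $\mathbb{R}_\geqslant=[0,\infty)$. The function $h\in C^1(\mathbb{R}_\geqslant;\mathbb{R})$ is strictly concave with $h(0)=0$, $h'(x)>0$ for $x>0$, $h'(0)=1$ and $\lim_{x\to\infty}h(x)/x=0$. The function $g:\Theta\to(0,\infty)$ is bounded and measurable. For $t\in\mathbb{R}$ let $f_t(\theta,x)=e^{-t}g(\theta)h(x)$ on $\Theta\times\mathbb{R}_\geqslant$, and iterate: $f_t^0(\theta,x)=x$, $f_t^1=f_t$, $f_t^n(\theta,x)=f_t(T^{n-1}\theta,f_t^{n-1}(\theta,x))$. For each $t$ fix $M_t>0$ such that $f_t(\theta,M_t)<M_t$ for all $\theta\in\Theta$ (such $M_t$ exists). Put $\psi_{t,n}(\theta)=f_t^n(T^{-n}\theta,M_t)$ and define the maximal invariant function $$\varphi_t(\theta)=\lim_{n\to\infty}\psi_{t,n}(\theta)=\inf_n\psi_{t,n}(\theta).$$ Set $N_t=\{\theta\in\Theta:\varphi_t(\theta)=0\}$. One has $N_t\subseteq N_s$ for $t<s$. Define $t_c(\theta)=\inf\{t\in\mathbb{R}:\varphi_t(\theta)=0\}$ and $S_t=\{\theta\in\Theta:t_c(\theta)=t\}$.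 *)

(* Defs.v *)
From HB Require Import structures.
From mathcomp Require Import all_boot all_order all_algebra.
From mathcomp Require Import all_classical all_reals all_analysis.

Set Implicit Arguments.
Unset Strict Implicit.
Unset Printing Implicit Defensive.

Import Order.TTheory GRing.Theory Num.Theory.
Import numFieldNormedType.Exports.

Local Open Scope classical_set_scope.
Local Open Scope ring_scope.

Definition bimeasurable (d : measure_display) (Theta : measurableType d)
    (T Tinv : Theta -> Theta) : Prop :=
  [/\ cancel T Tinv, cancel Tinv T,
      measurable_fun setT T & measurable_fun setT Tinv].

Definition invariant_measure (d : measure_display) (Theta : measurableType d)
    (R : realType) (T : Theta -> Theta) (mu : probability Theta R) : Prop :=
  forall A : set Theta, measurable A -> mu (T @^-1` A) = mu A.

(* Real functions on [0, +oo[ are encoded as functions R -> R whose values at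
   negative arguments are never constrained nor used. *)

(* [h'] is the derivative of [h] on [0, +oo[ (one-sided at 0) and it is
   continuous there. *)
Definition C1_ge0 (R : realType) (h h' : R -> R) : Prop :=
  (forall x : R, 0 <= x ->
     (h y - h x) / (y - x) @[y --> within `[0, +oo[ x^'] --> h' x) /\
  {within `[0, +oo[, continuous h'}.

Definition strictly_concave_ge0 (R : realType) (h : R -> R) : Prop :=
  forall x y a : R, 0 <= x -> 0 <= y -> x != y -> 0 < a -> a < 1 ->
    a * h x + (1 - a) * h y < h (a * x + (1 - a) * y).

Section SkewProduct.
Context (d : measure_display) (Theta : measurableType d) (R : realType).
Variables (T Tinv : Theta -> Theta) (g : Theta -> R) (h : R -> R) (M : R -> R).

Definition fibre (t : R) (theta : Theta) (x : R) : R :=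
  expR (- t) * g theta * h x.

Fixpoint fibre_iter (t : R) (n : nat) (theta : Theta) (x : R) : R :=
  if n is m.+1 then fibre t (iter m T theta) (fibre_iter t m theta x) else x.

Definition pullback (t : R) (n : nat) (theta : Theta) : R :=
  fibre_iter t n (iter n Tinv theta) (M t).

(* [pullback t ^~ theta] is nonincreasing and bounded below by 0 as soon as [h]
   is nonnegative and nondecreasing on [0, +oo[, [g] is positive, [M t] is
   positive and [fibre t _ (M t) < M t], so this is a genuine limit, equal to
   the infimum of the sequence. *)
Definition maximal_invariant (t : R) (theta : Theta) : R :=
  limn (fun n => pullback t n theta).

Definition zero_set (t : R) : set Theta :=
  [set theta | maximal_invariant t theta = 0].

(* The infimum is taken in \bar R: it is -oo when the maximal invariant
   function vanishes at theta for every parameter. *)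
Definition critical_parameter (theta : Theta) : \bar R :=
  ereal_inf [set t%:E | t in [set t : R | maximal_invariant t theta = 0]].

Definition critical_set (t : R) : set Theta :=
  [set theta | critical_parameter theta = t%:E].

End SkewProduct.

(* Main.v *)
Require Import Defs.
From HB Require Import structures.
From mathcomp Require Import all_boot all_order all_algebra.
From mathcomp Require Import all_classical all_reals all_analysis.
From mathcomp Require Import measurable_realfun ring lra.

Import Order.TTheory GRing.Theory Num.Theory.
Import numFieldNormedType.Exports.

Local Open Scope classical_set_scope.
Local Open Scope ring_scope.

(* Fix t < s = t + delta and let B be the T-invariant set where phi_t > 0 and
   phi_s = 0.  On B the functions p_n = max(0, ln(phi_t / psi_{s,n})) are
   bounded, increase with n, and satisfy p_{n+1}(T theta) <= p_n(theta) + delta;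
   integrating over B, the nonnegative defect in this inequality has integral at
   most delta, for every n.  Since psi_{s,n} -> 0 on B and y |-> h(y) / y is
   strictly decreasing, the defect is eventually at least
   L = ln(h(phi_t / 2) / (phi_t / 2)) - ln(h(phi_t) / phi_t) > 0, so Fatou's
   lemma gives int_B L <= delta.  The set S_t \ N_t is contained in B for every
   delta > 0, hence the integral over it of the positive function L vanishes. *)

(** * Lower limits and an integral bound from a drift inequality *)

Lemma le_limn_einf (R : realType) (u : (\bar R) ^nat) (l : \bar R) :
  (\forall n \near \oo, l <= u n)%E -> (l <= limn_einf u)%E.
Proof.
move=> [N _ H]; rewrite limn_einf_lim; apply: lime_ge; first exact: is_cvg_einfs.
exists N => // n /= Nn; apply/ereal_infP => _ [m /= nm <-].
by apply: H => /=; exact: leq_trans nm.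
Qed.

Lemma limn_einf_le (R : realType) (u : (\bar R) ^nat) (l : \bar R) :
  (forall n, u n <= l)%E -> (limn_einf u <= l)%E.
Proof.
move=> H; rewrite limn_einf_lim; apply: lime_le; first exact: is_cvg_einfs.
by apply: nearW => n; apply: le_trans (H n); apply: ereal_inf_lbound; exists n => /=.
Qed.

Lemma ge0_integral_invariant d (X : measurableType d) (R : realType)
    (T : X -> X) (mu : probability X R) (B : set X) (f : X -> \bar R) :
  measurable_fun setT T -> invariant_measure T mu -> measurable B ->
  T @^-1` B = B -> measurable_fun B f -> (forall x, B x -> 0 <= f x)%E ->
  (\int[mu]_(x in B) f (T x) = \int[mu]_(x in B) f x)%E.
Proof.
move=> mT muT mB TB mf f0.
rewrite -{1}TB -(ge0_integral_pushforward mT mu mB mf)//; last first.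
  by move=> x /set_mem/f0.
by apply: eq_measure_integral => A mA _; exact: muT.
Qed.

(** The defect [E n] is nonnegative, and by invariance its integral is [delta * mu B] minus the
    growth of the integral of [p n] from [n] to [n.+1], hence at most [delta]. The bound [K n] may
    grow with [n]: it only makes the integral of [p n] finite. *)
Lemma integral_drift_le d (X : measurableType d) (R : realType) (T : X -> X)
    (mu : probability X R) (B : set X) (p : nat -> X -> R) (K : nat -> R)
    (L : X -> R) (delta : R) :
  measurable_fun setT T -> invariant_measure T mu -> measurable B ->
  T @^-1` B = B -> (forall n, measurable_fun B (p n)) ->
  measurable_fun B L -> 0 <= delta ->
  (forall n x, B x -> 0 <= p n x <= K n) ->
  (forall n x, B x -> p n x <= p n.+1 x) ->
  (forall n x, B x -> p n.+1 (T x) <= p n x + delta) ->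
  (forall x, B x -> 0 <= L x) ->
  (forall x, B x -> \forall n \near \oo, p n.+1 (T x) <= p n x + delta - L x) ->
  (\int[mu]_(x in B) (L x)%:E <= delta%:E)%E.
Proof.
move=> mT muT mB TB mp mL delta0 p0 pS pT L0 pL.
pose E n x := p n x + delta - p n.+1 (T x).
have BT x : B x -> B (T x) by rewrite -{1}TB.
have mpT n : measurable_fun B (p n \o T).
  apply: (measurable_comp mB) (mp n) _; last exact: measurable_funTS.
  by move=> _ [x Bx <-]; exact: BT.
have mE n : measurable_fun B (E n).
  by apply: measurable_funB; [apply: measurable_funD|exact: mpT].
have E0 n x : B x -> 0 <= E n x by move=> Bx; rewrite subr_ge0; exact: pT.
have pfin n : (\int[mu]_(x in B) (p n x)%:E)%E \is a fin_num.
  rewrite ge0_fin_numE; last first.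
    by apply: integral_ge0 => x /(p0 n)/andP[]; rewrite lee_fin.
  have K0 x : B x -> (0 <= (K n)%:E)%E.
    by move=> /(p0 n)/andP[a b]; rewrite lee_fin (le_trans a).
  apply: (@le_lt_trans _ _ (\int[mu]_(x in B) (K n)%:E)%E).
    apply: ge0_le_integral => //.
    - by move=> x /(p0 n)/andP[]; rewrite lee_fin.
    - exact/measurable_EFinP.
    - by move=> x /(p0 n)/andP[]; rewrite lee_fin.
  (* That [K n] is nonnegative is known only through a point of [B], so the empty set is treated
     apart. *)
  have [->|/set0P[x Bx]] := eqVneq B set0; first by rewrite integral_set0.
  rewrite integral_cst// lte_mul_pinfty//; first exact: K0 Bx.
  by rewrite (le_lt_trans (probability_le1 _ mB)) ?ltry.
have intE n : (\int[mu]_(x in B) (E n x)%:E <= delta%:E)%E.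
  have H : (\int[mu]_(x in B) (p n x)%:E + \int[mu]_(x in B) delta%:E =
    \int[mu]_(x in B) (p n.+1 (T x))%:E + \int[mu]_(x in B) (E n x)%:E)%E.
    have mEp (f : X -> R) : measurable_fun B f -> measurable_fun B (EFin \o f).
      by move=> mf; exact/measurable_EFinP.
    rewrite -(ge0_integralD mu mB _ (mEp _ (mp n)) _ (measurable_cst _))//; last first.
      by move=> x /(p0 n)/andP[]; rewrite lee_fin.
    rewrite -(ge0_integralD mu mB _ (mEp _ (mpT n.+1)) _ (mEp _ (mE n))).
    - by apply: eq_integral => x _; rewrite /= -!EFinD /E; congr EFin; ring.
    - by move=> x Bx; rewrite lee_fin; case/andP: (p0 n.+1 (T x) (BT _ Bx)).
    - by move=> x Bx; rewrite lee_fin E0.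
  rewrite (ge0_integral_invariant _ _ _ _ _ _ (fun x => (p n.+1 x)%:E) mT muT mB TB) in H; last first.
  - by move=> x /(p0 n.+1)/andP[]; rewrite lee_fin.
  - exact/measurable_EFinP.
  have pp : (\int[mu]_(x in B) (p n x)%:E <= \int[mu]_(x in B) (p n.+1 x)%:E)%E.
    apply: ge0_le_integral => //.
    - by move=> x /(p0 n)/andP[]; rewrite lee_fin.
    - exact/measurable_EFinP.
    - exact/measurable_EFinP.
    - by move=> x Bx; rewrite lee_fin pS.
  apply: (@le_trans _ _ (\int[mu]_(x in B) delta%:E)%E).
    (* Adding the finite integral of [p n] to both sides turns the claim, through [H], into [pp]. *)
    by rewrite -(leeD2lE _ _ (pfin n)) H leeD2r.
  rewrite integral_cst// -[leRHS]mule1 lee_wpmul2l ?lee_fin//.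
  exact: probability_le1.
apply: (@le_trans _ _ (\int[mu]_(x in B) limn_einf (fun n => (E n x)%:E))%E).
  apply: ge0_le_integral => //.
  - exact/measurable_EFinP.
  - apply: measurableT_comp => //; apply: measurable_fun_limn_esup => n /=.
    by apply/measurable_EFinP; exact: measurable_funN.
  - move=> x Bx; apply: le_limn_einf; near=> n; rewrite lee_fin.
    have : p n.+1 (T x) <= p n x + delta - L x by near: n; exact: pL.
    by rewrite /E; lra.
apply: (le_trans (fatou mu mB _ _)).
- by move=> n; exact/measurable_EFinP.
- by move=> n x Bx; rewrite lee_fin E0.
- exact: limn_einf_le.
Unshelve. all: by end_near. Qed.

(** * Strictly concave functions on the half-line *)

Section ConcaveSkewProduct.
Context (R : realType) (h h' : R -> R).
Context (hC1 : C1_ge0 h h') (hconc : strictly_concave_ge0 h) (h0 : h 0 = 0).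
Context (h'_gt0 : forall x : R, 0 < x -> 0 < h' x) (h'0 : h' 0 = 1).

(** Points to the right of some [x >= 0] lie in the half-line and differ from [x], so the filter of
    [C1_ge0] restricts to them. This treats [x = 0] and [x > 0] alike. *)
Lemma difference_quotient_cvg_right (x : R) : 0 <= x ->
  (h y - h x) / (y - x) @[y --> x^'+] --> h' x.
Proof.
move=> x0; apply: cvg_trans (hC1.1 x x0) => P /=.
move=> nP; have {}nP : \forall y \near x, y != x -> y \in `[0, +oo[ ->
  P ((h y - h x) / (y - x)) by exact: nP.
apply: filterS nP => y H xy.
by apply: H => /=; rewrite ?gt_eqF// in_itv /= andbT (le_trans x0)// ltW.
Qed.

(** Strict concavity on the chord from 0 to [y], with [h 0 = 0]: this is the strict decrease of
    [h x / x], cleared of denominators. *)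
Lemma concave_slope_lt (x y : R) : 0 < x -> x < y -> x * h y < y * h x.
Proof.
move=> x0 xy; have y0 := lt_trans x0 xy.
have a1 : x / y < 1 by rewrite ltr_pdivrMr// mul1r.
have := hconc y 0 (x / y) (ltW y0) (lexx _) (lt0r_neq0 y0) (divr_gt0 x0 y0) a1.
rewrite h0 !mulr0 !addr0 divfK ?gt_eqF// => H.
by move: H; rewrite mulrAC ltr_pdivrMr// (mulrC (h x)).
Qed.

Lemma concave_slope_le (x y : R) : 0 < x -> x <= y -> x * h y <= y * h x.
Proof.
by move=> x0; rewrite le_eqVlt => /predU1P[->//|/(concave_slope_lt _ _ x0)/ltW].
Qed.

(** As [h' y > 0], some [z > y] has [h z > h y]. Since [y] lies between [x] and [z], its value
    exceeds a weighted mean of [h x] and [h z], which forces [h x < h y]. *)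
Lemma increasing_of_concave (x y : R) : 0 <= x -> x < y -> h x < h y.
Proof.
move=> x0 xy; have y0 := le_lt_trans x0 xy.
have /cvgr_gt H := difference_quotient_cvg_right y (ltW y0).
have [z [yz]] : exists z, y < z /\ 0 < (h z - h y) / (z - y).
  suff : \forall z \near y^'+, y < z /\ 0 < (h z - h y) / (z - y).
    by move/filter_ex.
  near=> z; split; near: z; first exact: nbhs_right_gt.
  by apply: H; exact: h'_gt0.
rewrite pmulr_lgt0 ?invr_gt0 ?subr_gt0// => hyz.
have xz := lt_trans xy yz.
pose a := (z - y) / (z - x).
have zx0 : 0 < z - x by rewrite subr_gt0.
have a0 : 0 < a by rewrite divr_gt0// subr_gt0.
have a1 : a < 1 by rewrite ltr_pdivrMr// mul1r ltrD2l ltrN2.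
have xnz : x != z by rewrite lt_eqF.
have := hconc x z a x0 (ltW (lt_trans y0 yz)) xnz a0 a1.
have -> : a * x + (1 - a) * z = y by rewrite /a; field; exact: lt0r_neq0.
move=> H2; have : a * (h y - h x) > 0 by nra.
by rewrite pmulr_rgt0// subr_gt0.
Unshelve. all: by end_near. Qed.

Lemma nondecreasing_of_concave (x y : R) : 0 <= x -> x <= y -> h x <= h y.
Proof.
move=> x0; rewrite le_eqVlt => /predU1P[->//|xy].
exact/ltW/increasing_of_concave.
Qed.

Lemma concave_gt0 (x : R) : 0 < x -> 0 < h x.
Proof. by move=> x0; rewrite -[ltLHS]h0; exact: increasing_of_concave. Qed.

Lemma concave_ge0 (x : R) : 0 <= x -> 0 <= h x.
Proof. by move=> x0; rewrite -[leLHS]h0; exact: nondecreasing_of_concave. Qed.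

(** The slopes [h z / z] tend to [h' 0 = 1] as [z] decreases to 0; a slope above 1 at [y] would
    exceed the slope at some smaller [z], against their decrease. *)
Lemma concave_le_id (y : R) : 0 <= y -> h y <= y.
Proof.
rewrite le_eqVlt => /predU1P[<-|y0]; first by rewrite h0.
rewrite leNgt; apply/negP => yhy.
have := difference_quotient_cvg_right 0 (lexx _); rewrite h'0 => /cvgr_lt.
have c1 : 1 < h y / y by rewrite ltr_pdivlMr// mul1r.
move=> /(_ _ c1) H.
have [z [z0 zy]] : exists z, [/\ 0 < z, z < y & (h z - h 0) / (z - 0) < h y / y].
  suff : \forall z \near 0^'+, [/\ 0 < z, z < y & (h z - h 0) / (z - 0) < h y / y].
    by move/filter_ex.
  near=> z; split; near: z => //; first exact: nbhs_right_gt.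
  exact: nbhs_right_lt.
rewrite h0 !subr0 ltr_pdivrMr// mulrAC ltr_pdivlMr//.
by have := concave_slope_lt _ _ z0 zy; lra.
Unshelve. all: by end_near. Qed.

Lemma concave_scale_le (c x : R) : 1 <= c -> 0 <= x -> h (c * x) <= c * h x.
Proof.
move=> c1; rewrite le_eqVlt => /predU1P[<-|x0]; first by rewrite !(mulr0, h0).
have xcx : x <= c * x by rewrite ler_peMl// ltW.
have := concave_slope_le _ _ x0 xcx; rewrite (mulrC c) -mulrA ler_pM2l//.
Qed.

(* Continuity from above comes from [h x <= h y <= (h x / x) * y]. *)
Lemma concave_cvg_above (u : R ^nat) (x : R) : 0 <= x -> (forall n, x <= u n) ->
  u @ \oo --> x -> h (u n) @[n --> \oo] --> h x.
Proof.
move=> x0 xu ux; move: x0; rewrite le_eqVlt => /predU1P[x0|x0].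
  move: ux xu; rewrite -x0 h0 => ux xu.
  apply: (squeeze_cvgr _ (cvg_cst 0) ux); near=> n.
  by rewrite concave_ge0 ?concave_le_id.
have H : h x / x * u n @[n --> \oo] --> h x / x * x by exact: cvgMl_tmp.
rewrite divfK ?gt_eqF// in H.
apply: (squeeze_cvgr _ (cvg_cst (h x)) H); near=> n.
rewrite nondecreasing_of_concave ?(ltW x0)//= mulrAC ler_pdivlMr//.
by have := concave_slope_le _ _ x0 (xu n); lra.
Unshelve. all: by end_near. Qed.

Lemma measurable_fun_concave d (T : measurableType d) (f : T -> R) :
  (forall x, 0 <= f x) -> measurable_fun setT f -> measurable_fun setT (h \o f).
Proof.
move=> f0 mf.
(* Nothing is known of [h] at negative arguments; truncating the argument at 0 gives a function
   monotone on the whole line, hence measurable. *)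
have -> : h \o f = (fun x => h (Num.max 0 x)) \o f.
  by apply/funext => x /=; rewrite max_r.
apply: measurableT_comp mf; apply: nondecreasing_measurable => // x y xy.
apply: nondecreasing_of_concave; first by rewrite le_max lexx.
by rewrite ge_max !le_max lexx xy orbT.
Qed.


(** * Pullback iterates and the maximal invariant function *)

Context (d : measure_display) (Theta : measurableType d).
Context (T Tinv : Theta -> Theta) (hT : bimeasurable T Tinv).
Context (g : Theta -> R) (M : R -> R).
Context (g_gt0 : forall theta, 0 < g theta) (g_meas : measurable_fun setT g).
Context (M_gt0 : forall t, 0 < M t).
Context (hM : forall t theta, fibre g h t theta (M t) < M t).

Let f := fibre g h.
Let psi := pullback T Tinv g h M.
Let phi := maximal_invariant T Tinv g h M.

(** Both orbits start at [iter n Tinv theta], because the extra backward step cancels [T]. *)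
Lemma pullbackS t n theta : psi t n.+1 (T theta) = f t theta (psi t n theta).
Proof.
have [TK TinvK _ _] := hT.
have iterK m th : iter m T (iter m Tinv th) = th.
  by elim: m th => // m IH th; rewrite iterSr iterS TinvK IH.
by rewrite /psi /pullback iterSr TK /= iterK.
Qed.

(** Every point has the form [T theta], so the inductive step may be checked there, where
    [pullbackS] applies. *)
Lemma pullback_ind (P : nat -> Theta -> Prop) : (forall theta, P 0%N theta) ->
  (forall n theta, P n theta -> P n.+1 (T theta)) -> forall n theta, P n theta.
Proof.
have [_ TinvK _ _] := hT.
move=> P0 PS; elim=> // n IH theta; by rewrite -[theta]TinvK; exact: PS.
Qed.

Let coef_gt0 t theta : 0 < expR (- t) * g theta.
Proof. by rewrite mulr_gt0 ?expR_gt0. Qed.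

Lemma fibre_nondecreasing t theta (x y : R) : 0 <= x -> x <= y ->
  f t theta x <= f t theta y.
Proof.
by move=> x0 xy; rewrite ler_pM2l ?coef_gt0//; exact: nondecreasing_of_concave.
Qed.

Lemma pullback_gt0 t n theta : 0 < psi t n theta.
Proof.
move: n theta; apply: pullback_ind => [theta|n theta IH]; first exact: M_gt0.
by rewrite pullbackS mulr_gt0 ?coef_gt0 ?concave_gt0.
Qed.

Lemma pullback_le t n theta : psi t n.+1 theta <= psi t n theta.
Proof.
move: n theta; apply: pullback_ind => [theta|n theta IH].
  have [_ TinvK _ _] := hT; rewrite -[theta]TinvK pullbackS; exact/ltW/hM.
by rewrite !pullbackS fibre_nondecreasing// ltW// pullback_gt0.
Qed.

Lemma pullback_cvg t theta : psi t n theta @[n --> \oo] --> phi t theta.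
Proof.
apply: nonincreasing_is_cvgn; last by exists 0 => _ [n _ <-]; exact/ltW/pullback_gt0.
by apply/nonincreasing_seqP => n; exact: pullback_le.
Qed.

Lemma maximal_invariant_ge0 t theta : 0 <= phi t theta.
Proof.
apply: limr_ge; first exact: pullback_cvg.
by apply: nearW => n; exact/ltW/pullback_gt0.
Qed.

Lemma maximal_invariant_le t n theta : phi t theta <= psi t n theta.
Proof.
apply: (@nonincreasing_cvgn_ge _ (fun n => psi t n theta)); last exact: pullback_cvg.
by apply/nonincreasing_seqP => m; exact: pullback_le.
Qed.

(** Pass to the limit in [pullbackS]; the pullbacks approach [phi] from above, so continuity of [h]
    from above suffices. *)
Lemma maximal_invariantT t theta : phi t (T theta) = f t theta (phi t theta).
Proof.
have H : f t theta (psi t n theta) @[n --> \oo] --> f t theta (phi t theta).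
  apply: cvgMl_tmp; apply: (concave_cvg_above (fun n => psi t n theta)).
  - exact: maximal_invariant_ge0.
  - by move=> n; exact: maximal_invariant_le.
  - exact: pullback_cvg.
rewrite -(cvg_lim (@Rhausdorff R) H); apply/esym/cvg_lim; first exact: Rhausdorff.
have := pullback_cvg t (T theta); rewrite -(cvg_shiftS (fun n => psi t n (T theta))).
by under eq_fun do rewrite pullbackS.
Qed.

(** On the half-line each fibre map vanishes exactly at 0. This yields the [T]-invariance of the set
    of integration. *)
Lemma zero_setT t theta : (phi t (T theta) == 0) = (phi t theta == 0).
Proof.
rewrite maximal_invariantT mulf_eq0 gt_eqF ?coef_gt0//=.
have := maximal_invariant_ge0 t theta; rewrite le_eqVlt => /predU1P[<-|phi0].
  by rewrite h0.
by rewrite !gt_eqF// concave_gt0.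
Qed.

(** The starting heights [M s] and [M t] are unrelated, hence the factor. It is at least 1, so it
    survives each step by [concave_scale_le], while [expR (- s) <= expR (- t)]. *)
Lemma pullback_le_scale (s t : R) n theta : t <= s ->
  psi s n theta <= Num.max 1 (M s / M t) * psi t n theta.
Proof.
move=> ts; move: n theta; set c := Num.max _ _.
have c1 : 1 <= c by rewrite le_max lexx.
apply: pullback_ind => [theta|n theta IH].
  by rewrite -ler_pdivrMr ?pullback_gt0// le_max lexx orbT.
rewrite !pullbackS mulrCA.
have psi0 := ltW (pullback_gt0 t n theta).
apply: (@le_trans _ _ (f t theta (psi s n theta))).
  rewrite ler_wpM2r ?concave_ge0 ?(ltW (pullback_gt0 _ _ _))//.
  by rewrite ler_pM2r// ler_expR lerN2.
rewrite ler_pM2l ?coef_gt0//; apply: le_trans (concave_scale_le _ _ c1 psi0).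
exact: nondecreasing_of_concave (ltW (pullback_gt0 _ _ _)) IH.
Qed.

Lemma zero_set_nondecreasing (s t : R) theta : t <= s -> phi t theta = 0 ->
  phi s theta = 0.
Proof.
move=> ts phit; apply/eqP; rewrite eq_le maximal_invariant_ge0 andbT.
have H : Num.max 1 (M s / M t) * psi t n theta @[n --> \oo] --> (0 : R).
  by rewrite -[X in _ --> X](mulr0 (Num.max 1 (M s / M t))) -phit;
    apply: cvgMl_tmp; exact: pullback_cvg.
rewrite -(cvg_lim (@Rhausdorff R) H); apply: ler_lim.
- exact: pullback_cvg.
- by apply/cvg_ex; exists 0.
- by apply: nearW => n; exact: pullback_le_scale.
Qed.

Lemma measurable_pullback t n : measurable_fun setT (psi t n).
Proof.
have [_ TinvK mT mTinv] := hT.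
elim: n => [|n IH]; first exact: measurable_cst.
have -> : psi t n.+1 = (fun theta => f t theta (psi t n theta)) \o Tinv.
  by apply/funext => theta /=; rewrite -pullbackS TinvK.
apply: measurableT_comp mTinv; apply: measurable_funM; first exact: measurable_funM.
apply: measurable_fun_concave IH => theta; exact/ltW/pullback_gt0.
Qed.

Lemma measurable_maximal_invariant t : measurable_fun setT (phi t).
Proof.
apply: (measurable_fun_cvg (measurable_pullback t)) => theta _.
exact: pullback_cvg.
Qed.

(** * Logarithmic estimates for the fibre maps *)

Lemma ln_fibre t theta (x : R) : 0 < x ->
  ln (f t theta x) = - t + ln (g theta) + ln (h x).
Proof.
move=> x0; rewrite /f /fibre lnM ?posrE ?coef_gt0 ?concave_gt0//.
by rewrite lnM ?posrE ?expR_gt0// expRK.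
Qed.

(** For [y <= x] monotonicity of [h] makes the left side nonpositive; for [x < y] the decrease of
    [h x / x] gives the second bound. *)
Lemma ln_concave_sub_le (x y : R) : 0 < x -> 0 < y ->
  ln (h y) - ln (h x) <= Num.max 0 (ln y - ln x).
Proof.
move=> x0 y0; have hx := concave_gt0 _ x0; have hy := concave_gt0 _ y0.
rewrite le_max; case: (leP y x) => xy; apply/orP; [left|right].
  by rewrite subr_le0 ler_ln ?posrE// nondecreasing_of_concave// ltW.
suff : ln x + ln (h y) <= ln y + ln (h x) by lra.
rewrite -!lnM ?posrE// ler_ln ?posrE ?mulr_gt0//.
exact/concave_slope_le/ltW.
Qed.

(* [gain x = ln (k (x / 2)) - ln (k x)] for the strictly decreasing
   [k y = h y / y]. *)
Let gain (x : R) := ln (h (x / 2)) + ln 2 - ln (h x).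

Lemma gain_gt0 (x : R) : 0 < x -> 0 < gain x.
Proof.
move=> x0; have x2 : 0 < x / 2 by rewrite divr_gt0.
have hx := concave_gt0 _ x0; have hx2 := concave_gt0 _ x2.
rewrite subr_gt0 -lnM ?posrE// ltr_ln ?posrE ?mulr_gt0//.
have xx2 : x / 2 < x by lra.
by have := concave_slope_lt _ _ x2 xx2; rewrite mulrAC ltr_pdivrMr// -mulrA ltr_pM2l.
Qed.

(** The slope of [h] at [x] is at least the one at [y / 2], whose logarithm exceeds that at [y] by
    exactly [gain y]. *)
Lemma ln_concave_sub_le_gain (x y : R) : 0 < x -> x <= y / 2 ->
  ln (h y) - ln (h x) <= ln y - ln x - gain y.
Proof.
move=> x0 xy; have y2 : 0 < y / 2 by apply: lt_le_trans xy.
have y0 : 0 < y by lra.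
have hx := concave_gt0 _ x0; have hy2 := concave_gt0 _ y2.
have : ln (x * h (y / 2)) <= ln (y / 2 * h x).
  by rewrite ler_ln ?posrE ?mulr_gt0//; exact: concave_slope_le.
by rewrite lnM ?posrE// lnM ?posrE// ln_div ?posrE// /gain; lra.
Qed.

(** * Integration over the transition sets and the null set *)

Context (mu : probability Theta R) (hmu : invariant_measure T mu).

Let transition t s := [set theta | phi t theta != 0 /\ phi s theta = 0].

Lemma measurable_transition t s : measurable (transition t s).
Proof.
have mz r : measurable [set theta | phi r theta = 0].
  rewrite -[X in measurable X]setTI.
  exact: (measurable_maximal_invariant r measurableT _ (measurable_set1 (0 : R))).
have -> : transition t s = ~` [set theta | phi t theta = 0] `&` [set theta | phi s theta = 0].
  by apply/seteqP; split=> theta /= [/eqP].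
by apply: measurableI => //; exact: measurableC.
Qed.

Lemma measurable_gain t : measurable_fun setT (gain \o phi t).
Proof.
have mln (u : Theta -> R) : (forall theta, 0 <= u theta) ->
    measurable_fun setT u -> measurable_fun setT (fun theta => ln (h (u theta))).
  move=> u0 mu_; apply: (measurableT_comp (@measurable_ln R)).
  exact: measurable_fun_concave.
have phi0 := maximal_invariant_ge0 t; have mphi := measurable_maximal_invariant t.
apply: measurable_funB; last exact: mln.
apply: measurable_funD => //; apply: mln; last exact: measurable_funM.
by move=> theta; rewrite divr_ge0.
Qed.

Lemma integral_gain_le (t delta : R) : 0 < delta ->
  (\int[mu]_(theta in transition t (t + delta)) (gain (phi t theta))%:E <= delta%:E)%E.
Proof.
move=> delta0; set s := t + delta.
pose p n theta := Num.max 0 (ln (phi t theta) - ln (psi s n theta)).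
have [_ _ mT _] := hT.
have phi_gt0 theta : transition t s theta -> 0 < phi t theta.
  by move=> [phi0 _]; rewrite lt_neqAle eq_sym phi0 maximal_invariant_ge0.
have pT n theta : transition t s theta ->
    p n.+1 (T theta) = Num.max 0 (delta + (ln (h (phi t theta)) - ln (h (psi s n theta)))).
  (* Both fibre maps carry the same factor [g theta], which cancels; the exponential factors leave
     [s - t = delta]. *)
  move=> /phi_gt0 phi0; rewrite /p maximal_invariantT pullbackS !ln_fibre ?pullback_gt0//.
  by congr Num.max; rewrite /s; ring.
have pT_le n theta : transition t s theta -> p n.+1 (T theta) <= p n theta + delta.
  move=> B; have phi0 := phi_gt0 _ B; rewrite pT// ge_max; apply/andP; split.
    by rewrite addr_ge0 ?(ltW delta0)// le_max lexx.
  by rewrite addrC lerD2r; exact: ln_concave_sub_le (pullback_gt0 _ _ _) phi0.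
have transitionT : T @^-1` transition t s = transition t s.
  apply/seteqP; split=> theta; rewrite /transition /=.
    by rewrite zero_setT => -[? /eqP]; rewrite zero_setT => /eqP.
  by move=> [? /eqP phi0]; rewrite zero_setT; split=> //; apply/eqP; rewrite zero_setT.
(* The bound [K n] starts from [phi t theta <= M t] and [psi s 0 theta = M s], and each step adds at
   most [delta]. *)
apply: (integral_drift_le _ _ _ T mu _ p
  (fun n => Num.max 0 (ln (M t) - ln (M s)) + delta *+ n)) => //.
- exact: measurable_transition.
- move=> n; apply/measurable_funTS/measurable_maxr => //; apply: measurable_funB.
    exact: (measurableT_comp (@measurable_ln R)) (measurable_maximal_invariant t).
  exact: (measurableT_comp (@measurable_ln R)) (measurable_pullback s n).
- exact/measurable_funTS/measurable_gain.
- exact: ltW.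
- move=> n theta B; rewrite le_max lexx /=; move: n theta B.
  apply: pullback_ind => [theta B|n theta IH B].
    rewrite addr0 ge_max le_max lexx /= le_max; apply/orP; right.
    rewrite lerD2r ler_ln ?posrE ?phi_gt0//; exact: maximal_invariant_le 0%N _.
  have B' : transition t s theta by rewrite -transitionT.
  by rewrite (le_trans (pT_le n _ B'))// mulrSr addrA lerD2r IH.
- move=> n theta _; rewrite ge_max !le_max lexx /= lerD2l lerN2.
  by rewrite ler_ln ?posrE ?pullback_gt0// pullback_le orbT.
- by move=> theta /phi_gt0/gain_gt0/ltW.
- move=> theta B; have phi0 := phi_gt0 _ B.
  have : \forall n \near \oo, psi s n theta <= phi t theta / 2.
    apply: cvgr_le (pullback_cvg s theta) _ _.
    by rewrite B.2 divr_gt0.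
  apply: filterS => n psi_le; have psi0 := pullback_gt0 s n theta.
  have := ln_concave_sub_le_gain _ _ psi0 psi_le.
  (* This makes the second argument of the maximum in [pT] nonnegative, so the truncation at 0 is
     inactive. *)
  have le1 : ln (h (psi s n theta)) <= ln (h (phi t theta)).
    rewrite ler_ln ?posrE ?concave_gt0// nondecreasing_of_concave ?(ltW psi0)//.
    by lra.
  have : ln (phi t theta) - ln (psi s n theta) <= p n theta by rewrite le_max lexx orbT.
  by rewrite pT// max_r; lra.
Qed.

(** By [zero_set_nondecreasing] the parameters with [phi = 0] form an up-closed set. Its infimum is
    [t], without [t] belonging to it, exactly when it contains every [t + n.+1%:R^-1] but not [t]. A
    countable intersection also gives measurability. *)
Lemma critical_setD_zero_setE t :
  critical_set T Tinv g h M t `\` zero_set T Tinv g h M t =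
  \bigcap_n transition t (t + n.+1%:R^-1).
Proof.
apply/seteqP; split=> theta.
  move=> [crit /eqP phi0] n _; split=> //.
  have /ereal_inf_lt[_ [r phir <-]] : (critical_parameter T Tinv g h M theta <
      (t + n.+1%:R^-1)%:E)%E by rewrite crit lte_fin ltrDl.
  by rewrite lte_fin => /ltW rt; exact: zero_set_nondecreasing rt phir.
move=> H; have [phi0 _] := H 0%N I; split; last exact/eqP.
apply/eqP; rewrite eq_le; apply/andP; split.
  apply/lee_addgt0Pr => e e0; apply: ereal_inf_lbound; exists (t + e) => //.
  have [k kt] := @ltr_add_invr R t (t + e) (ltac:(lra)).
  by apply: zero_set_nondecreasing (ltW kt) _; case: (H k I).
apply/ereal_infP => _ [r phir <-]; rewrite lee_fin leNgt; apply/negP => /ltW rt.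
by move/eqP: phi0; apply; exact: zero_set_nondecreasing rt phir.
Qed.

Lemma critical_setD_zero_set_null t :
  mu (critical_set T Tinv g h M t `\` zero_set T Tinv g h M t) = 0%E.
Proof.
rewrite critical_setD_zero_setE; set A := \bigcap_n _.
have mA : measurable A by apply: bigcap_measurable => // n _; exact: measurable_transition.
have mgain : measurable_fun setT (EFin \o (gain \o phi t)).
  exact/measurable_EFinP/measurable_gain.
have gainA s : {in transition t s, forall theta, 0 < gain (phi t theta)}.
  move=> theta /set_mem[phi0 _]; apply: gain_gt0.
  by rewrite lt_neqAle eq_sym phi0 maximal_invariant_ge0.
have A_gain theta : A theta -> 0 < gain (phi t theta).
  by move=> /(_ 0%N I)/mem_set; exact: gainA.
have intA : (\int[mu]_(theta in A) (gain (phi t theta))%:E <= 0)%E.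
  apply/lee_addgt0Pr => e e0; rewrite add0e.
  have [k] := @ltr_add_invr R 0 e e0; rewrite add0r => ke.
  apply: (@le_trans _ _ (k.+1%:R^-1)%:E); last by rewrite lee_fin ltW.
  apply: le_trans (integral_gain_le t _ _); last by rewrite invr_gt0.
  apply: ge0_subset_integral => //.
  - exact: measurable_transition.
  - exact: measurable_funTS.
  - by move=> theta /mem_set/gainA/ltW.
  - by move=> theta; apply.
apply: measure_negligible => //.
(* A nonnegative function with zero integral vanishes almost everywhere; [gain] is positive on all
   of [A], so the exceptional set contains [A]. *)
have : ae_eq mu A (EFin \o (gain \o phi t)) (cst 0%E).
  apply/ae_eq_integral_abs => //; first exact: measurable_funTS.
  apply/eqP; rewrite eq_le integral_ge0 ?andbT// (le_trans _ intA)//.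
  rewrite le_eqVlt; apply/orP; left; apply/eqP; apply: eq_integral => theta /set_mem/A_gain/ltW g0.
  by rewrite gee0_abs.
apply: negligibleS => theta Atheta /(_ Atheta) /= [].
by move/eqP; rewrite gt_eqF ?A_gain.
Qed.

End ConcaveSkewProduct.

Theorem corollary1 (R : realType) (d : measure_display)
    (Theta : measurableType d) (T Tinv : Theta -> Theta)
    (hT : bimeasurable T Tinv)
    (h h' : R -> R)
    (hC1 : C1_ge0 h h')
    (hconc : strictly_concave_ge0 h)
    (h0 : h 0 = 0)
    (h'_gt0 : forall x : R, 0 < x -> 0 < h' x)
    (h'0 : h' 0 = 1)
    (hlim : h x / x @[x --> +oo] --> (0 : R))
    (g : Theta -> R)
    (g_gt0 : forall theta : Theta, 0 < g theta)
    (g_bnd : bounded_fun (g : Theta -> R^o))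
    (g_meas : measurable_fun setT g)
    (M : R -> R)
    (M_gt0 : forall t : R, 0 < M t)
    (hM : forall (t : R) (theta : Theta), fibre g h t theta (M t) < M t)
    (mu : probability Theta R)
    (hmu : invariant_measure T mu)
    (t : R) :
  mu (critical_set T Tinv g h M t `\` zero_set T Tinv g h M t) = 0%E.
Proof.
exact: (critical_setD_zero_set_null R h h').
Qed.
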